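(* Let $k$ be a perfect field of characteristic $p>0$ and let $g\geq 1$ be an integer. Then the construction $\mathrm{HW}\colon (M,F,V,b) \mapsto (Q,\Phi,\Psi)$ (described in the context) gives a bijection $$\Bigl\{\text{isomorphism classes of polarized Dieudonné modules } (M,F,V,b) \text{ over } k \text{ with } \dim_k(M)=2g\Bigr\} \xrightarrow{\ \sim\ } \Bigl\{\text{isomorphism classes of HW-triples } (Q,\Phi,\Psi) \text{ over } k \text{ with } \dim_k(Q)=g\Bigr\},$$ whose inverse is given by the construction $\mathrm{DM}\colon (Q,\Phi,\Psi)\mapsto (M,F,V,b)$ (described in the context).
   Context: Let $\sigma\colon k\to k$ be the Frobenius automorphism $x \mapsto x^p$. For a vector space $Q$, $Q^\vee$ denotes its $k$-linear dual. A Dieudonné module over $k$ means a triple $(M,F,V)$ with $M$ a finite dimensional $k$-vector space, $F\colon M\to M$ $\sigma$-linear, $V\colon M \to M$ $\sigma^{-1}$-linear, $\operatorname{Ker}(F)=\operatorname{Image}(V)$ and $\operatorname{Ker}(V)=\operatorname{Image}(F)$. A polarized Dieudonné module $(M,F,V,b)$ is a Dieudonné module together with a non-degenerate alternating bilinear form $b\colon M\times M\to k$ such that $b(F(x),y)=b(x,V(y))^p$ for all $x,y\in M$. (Then $\dim_k M$ is even and $\operatorname{Ker}(F)$, $\operatorname{Ker}(V)$ are maximal isotropic.) Isomorphisms of polarized Dieudonné modules are $k$-linear bijections compatible with $F$, $V$ and $b$. An HW-triple (Hasse--Witt triple) over $k$ is a triple $(Q,\Phi,\Psi)$ with $Q$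 a finite dimensional $k$-vector space, $\Phi\colon Q\to Q$ a $\sigma$-linear map, and $\Psi\colon\operatorname{Ker}(\Phi)\xrightarrow{\sim}\operatorname{Image}(\Phi)^\perp$ a $\sigma$-linear bijective map, where $\operatorname{Image}(\Phi)^\perp=\{\lambda\in Q^\vee\mid\lambda(q)=0\text{ for all }q\in\operatorname{Image}(\Phi)\}$. An isomorphism $(Q_1,\Phi_1,\Psi_1)\to(Q_2,\Phi_2,\Psi_2)$ is a $k$-linear bijection $f\colon Q_1\to Q_2$ with $\Phi_2\circ f=f\circ\Phi_1$ and $\Psi_2\circ f=(f^{\vee})^{-1}\circ\Psi_1$ on $\operatorname{Ker}(\Phi_1)$. Construction $\mathrm{HW}$: given $(M,F,V,b)$, let $Q=M/\operatorname{Ker}(F)$ and let $\Phi$ be the composition $M/\operatorname{Ker}(F)\xrightarrow{F}M\twoheadrightarrow M/\operatorname{Ker}(F)$. For $x\in\operatorname{Ker}(\Phi)$ we have $F(x)\in\operatorname{Ker}(F)$, which is isotropic, so $b(-,F(x))$ is an element of $Q^\vee=(M/\operatorname{Ker}(F))^\vee\subset M^\vee$; put $\Psi(x)=b(-,F(x))$. Construction $\mathrm{DM}$: given $(Q,\Phi,\Psi)$, let $M=Q\oplus Q^\vee$ with $b((q,\lambda),(q',\lambda'))=\lambda'(q)-\lambda(q')$. Put $R_1=\operatorname{Ker}(\Phi)$, choose a complement $R_0$ of $R_1$ in $Q$, define $F(r_0+r_1,\lambda)=(\Phi(r_0),\Psi(r_1))$ for $r_0\in R_0$, $r_1\in R_1$,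 $\lambda\in Q^\vee$, and let $V$ be the unique map such that $b(F(x),y)=b(x,V(y))^p$ for all $x,y\in M$. (The isomorphism class of the result does not depend on the choice of $R_0$.) *)

(* Defs.v *)
From HB Require Import structures.
From mathcomp Require Import all_boot all_order all_algebra.
From mathcomp Require Import sesquilinear ring_quotient generic_quotient.

Set Implicit Arguments.
Unset Strict Implicit.
Unset Printing Implicit Defensive.

Import GRing.Theory.
Local Open Scope ring_scope.
Local Open Scope quotient_scope.

(* For k of characteristic p. *)
Definition perfect_field (k : fieldType) (p : nat) : Prop :=
  forall x : k, exists y : k, y ^+ p == x.

Section FrobeniusInverse.
Variables (k : fieldType) (p : nat).
Variables (hp : p \in [pchar k]) (hk : perfect_field k p).

(* The inverse of the Frobenius automorphism; the proof that k has
   characteristic p is an argument only so that the ring morphism structure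
   below can be inferred. *)
Definition frobV (_ : p \in [pchar k]) (hk : perfect_field k p) (x : k) : k :=
  xchoose (hk x).

Local Notation s := (pFrobenius_aut hp).
Local Notation t := (frobV hp hk).

Lemma frobVK : cancel t s.
Proof. by move=> x; apply/eqP/(xchooseP (hk x)). Qed.

Lemma frobK : cancel s t.
Proof. by move=> x; apply: (fmorph_inj s); rewrite /= frobVK. Qed.

Fact frobV_nmod : nmod_morphism t.
Proof.
split=> [|x y]; apply: (fmorph_inj s).
  by rewrite /= frobVK [RHS]rmorph0.
by rewrite /= frobVK [RHS]rmorphD /= !frobVK.
Qed.

Fact frobV_monoid : monoid_morphism t.
Proof.
split=> [|x y]; apply: (fmorph_inj s).
  by rewrite /= frobVK [RHS]rmorph1.
by rewrite /= frobVK [RHS]rmorphM /= !frobVK.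
Qed.

HB.instance Definition _ := GRing.isNmodMorphism.Build k k t frobV_nmod.
HB.instance Definition _ := GRing.isMonoidMorphism.Build k k t frobV_monoid.

End FrobeniusInverse.

Section Semilinear.
Variables (k : fieldType) (s t : {rmorphism k -> k}).
Hypotheses (sK : cancel s t) (tK : cancel t s).
Variables (U V : vectType k) (f : {linear U -> V | s \; *:%R}).

(* Applies r to the coordinates in a fixed basis. *)
Definition twist (r : k -> k) (W : vectType k) (v : W) : W :=
  \sum_i r (coord (vbasis fullv) i v) *: (vbasis (fullv : {vspace W}))`_i.
Arguments twist r {W} v.

Lemma coord_twist r (W : vectType k) (v : W) i :
  coord (vbasis fullv) i (twist r v) = r (coord (vbasis fullv) i v).
Proof. by rewrite coord_sum_free ?(basis_free (vbasisP _)). Qed.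

Lemma twistK (r r' : k -> k) : cancel r r' -> 
  forall W : vectType k, cancel (@twist r W) (twist r').
Proof.
move=> rK W v; rewrite [RHS](coord_vbasis (memvf v)).
by apply: eq_bigr => i _; rewrite coord_twist rK.
Qed.

Lemma twistD (r : {rmorphism k -> k}) (W : vectType k) : {morph @twist r W : u v / u + v}.
Proof.
move=> u v; rewrite -big_split; apply: eq_bigr => i _ /=.
by rewrite linearD rmorphD scalerDl.
Qed.

Lemma twistZ (r : {rmorphism k -> k}) (W : vectType k) a (v : W) :
  twist r (a *: v) = r a *: twist r v.
Proof.
rewrite scaler_sumr; apply: eq_bigr => i _ /=.
by rewrite linearZ /= rmorphM scalerA.
Qed.

Definition untwist (v : U) : V := f (twist t v).
Fact untwist_is_linear : linear untwist.
Proof.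
by move=> a u v; rewrite /untwist twistD twistZ linearD linearZ /= tK.
Qed.
HB.instance Definition _ := GRing.isLinear.Build k U V _ untwist untwist_is_linear.

Definition semi_img : {vspace V} := limg (linfun untwist).
Definition semi_ker : {vspace U} := <<map (twist t) (vbasis (lker (linfun untwist)))>>%VS.

Lemma mem_semi_img y : reflect (exists x, y = f x) (y \in semi_img).
Proof.
apply: (iffP memv_imgP) => [[x _ ->]|[x ->]].
  by exists (twist t x); rewrite lfunE.
by exists (twist s x); rewrite ?memvf // lfunE /= /untwist twistK.
Qed.

Lemma mem_semi_ker x : (x \in semi_ker) = (f x == 0).
Proof.
apply/idP/eqP => [/coord_span -> | fx0].
  rewrite linear_sum big1 // => i _; rewrite linearZ /=.
  rewrite (nth_map 0) ?size_tuple //.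
  have := vbasis_mem (mem_nth 0 (_ : i < size (vbasis (lker (linfun untwist))))%N).
  rewrite size_tuple ltn_ord memv_ker lfunE /= => /(_ isT) /eqP.
  by rewrite /untwist => ->; rewrite scaler0.
pose y := twist s x.
have yK : y \in lker (linfun untwist).
  by rewrite memv_ker lfunE /= /untwist twistK // fx0.
rewrite -[x](twistK sK) -/y (coord_vbasis yK).
have twist_sum I r (P : pred I) F :
    twist t (\sum_(i <- r | P i) F i) = \sum_(i <- r | P i) twist t (F i) :> U.
  apply: (big_morph _ (@twistD t U)).
  by rewrite -[0 in LHS](scale0r (0 : U)) twistZ rmorph0 scale0r.
rewrite twist_sum; apply: rpred_sum => i _; rewrite twistZ rpredZ //.
by apply: memv_span; rewrite map_f // mem_nth // size_tuple.
Qed.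
End Semilinear.

Section QuotientSpace.
Variables (k : fieldType) (V : vectType k) (U : {vspace V}).

(* The quotient V / U, as a quotient type; qpi is the projection. *)
Definition quotv : Type := @Quotient.quot V (pred_of_vspace U).
HB.instance Definition _ := EqQuotient.on quotv.
HB.instance Definition _ := GRing.Zmodule.on quotv.

Definition qpi (x : V) : quotv := \pi_quotv x.

Lemma qpiE x y : (qpi x == qpi y) = (x - y \in U).
Proof. by rewrite /qpi -Quotient.idealrBE. Qed.

Lemma reprqK (q : quotv) : qpi (repr q) = q.
Proof. exact: reprK. Qed.

Lemma repr_qpi x : repr (qpi x) - x \in U.
Proof. by rewrite -qpiE reprqK. Qed.

Fact qpi_is_zmod_morphism : zmod_morphism qpi.
Proof. by move=> x y; rewrite /qpi !piE. Qed.
HB.instance Definition _ := GRing.isZmodMorphism.Build V quotv qpi qpi_is_zmod_morphism.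

Lemma qpi_eq0 x : (qpi x == 0) = (x \in U).
Proof. by rewrite -(raddf0 qpi) qpiE subr0. Qed.

Definition scaleq (a : k) (q : quotv) : quotv := qpi (a *: repr q).

Lemma scaleq_qpi a x : scaleq a (qpi x) = qpi (a *: x).
Proof. by apply/eqP; rewrite qpiE -scalerBr rpredZ ?repr_qpi. Qed.

Fact scaleqA a b q : scaleq a (scaleq b q) = scaleq (a * b) q.
Proof. by rewrite -[q]reprqK !scaleq_qpi scalerA. Qed.
Fact scale1q : left_id 1 scaleq.
Proof. by move=> q; rewrite -[q]reprqK !scaleq_qpi scale1r. Qed.
Fact scaleqDr : right_distributive scaleq +%R.
Proof.
by move=> a q r; rewrite -[q]reprqK -[r]reprqK -raddfD !scaleq_qpi scalerDr raddfD.
Qed.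
Fact scaleqDl q : {morph scaleq^~ q : a b / a + b}.
Proof. by move=> a b; rewrite -[q]reprqK !scaleq_qpi scalerDl raddfD. Qed.
HB.instance Definition _ := GRing.Zmodule_isLmodule.Build k quotv
  scaleqA scale1q scaleqDr scaleqDl.

Fact qpi_is_scalable : scalable qpi.
Proof. by move=> a x; rewrite -scaleq_qpi. Qed.
HB.instance Definition _ := GRing.isScalable.Build k V quotv *:%R qpi qpi_is_scalable.

(* The coordinates of a class are those of the projection of a representative
   to a complement of U along U. *)
Definition quotv_coord (q : quotv) : 'rV[k]_(\dim U^C) :=
  \row_i coord (vbasis U^C) i (daddv_pi U^C U (repr q)).

Lemma quotv_coord_qpi x :
  quotv_coord (qpi x) = \row_i coord (vbasis U^C) i (daddv_pi U^C U x).
Proof.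
apply/rowP=> i; rewrite !mxE; congr coord; apply/eqP; rewrite -subr_eq0 -linearB /=.
have UU' : (U :&: U^C)%VS = 0%VS by exact: capv_compl.
have := daddv_pi_add (etrans (capvC _ _) UU')
  (_ : repr (qpi x) - x \in (U^C + U)%VS).
rewrite addvC addv_complf memvf => /(_ isT).
by rewrite (daddv_pi_id UU') ?repr_qpi // => /(canRL (addrK _)) ->; rewrite subrr.
Qed.

Fact quotv_vect_axiom : Vector.axiom (\dim U^C) quotv.
Proof.
have UU' : (U^C :&: U)%VS = 0%VS by rewrite capvC capv_compl.
exists quotv_coord.
  move=> a q r; rewrite -[q]reprqK -[r]reprqK -linearP !quotv_coord_qpi.
  by apply/rowP=> i; rewrite !mxE !linearP.
exists (fun r : 'rV_(\dim U^C) => qpi (\sum_i r 0 i *: (vbasis U^C)`_i)).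
  move=> q; rewrite -[q in RHS]reprqK -[q in LHS]reprqK quotv_coord_qpi.
  under eq_bigr do rewrite mxE.
  rewrite -(coord_vbasis (memv_pi _ _ _)); apply/eqP; rewrite qpiE.
  have := daddv_pi_add UU' (_ : repr q \in (U^C + U)%VS).
  rewrite addvC addv_complf memvf => /(_ isT) e.
  by rewrite -[X in _ - X]e opprD addrA subrr add0r rpredN memv_pi.
move=> r; rewrite quotv_coord_qpi; apply/rowP=> i; rewrite mxE daddv_pi_id //.
  by rewrite coord_sum_free ?(basis_free (vbasisP _)).
by apply: rpred_sum => j _; rewrite rpredZ ?vbasis_mem ?memt_nth.
Qed.
HB.instance Definition _ := Lmodule_hasFinDim.Build k quotv quotv_vect_axiom.

End QuotientSpace.

Definition complement (k : fieldType) (W : vectType k) (R1 R0 : {vspace W}) : Prop :=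
  (R1 :&: R0 = 0)%VS /\ (R1 + R0 = fullv)%VS.

Section Duality.
Variables (k : fieldType).

Definition dual (Q : vectType k) : vectType k := 'Hom(Q, k^o).

Definition nondegenerate_form (M : vectType k) (b : M -> M -> k) : Prop :=
  forall x, (forall y, b x y = 0) -> x = 0.

Definition dual_fun (Q1 Q2 : vectType k) (f : 'Hom(Q1, Q2)) (l : dual Q2) : dual Q1 :=
  (l \o f)%VF.
Fact dual_fun_is_linear Q1 Q2 f : linear (@dual_fun Q1 Q2 f).
Proof. by move=> a l m; rewrite /dual_fun comp_lfunDl comp_lfunZl. Qed.
HB.instance Definition _ Q1 Q2 f :=
  GRing.isLinear.Build k (dual Q2) (dual Q1) _ (@dual_fun Q1 Q2 f) (dual_fun_is_linear f).

Definition dual_map (Q1 Q2 : vectType k) (f : 'Hom(Q1, Q2)) : 'Hom(dual Q2, dual Q1) :=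
  linfun (dual_fun f).

Section Riesz.
Variables (M : vectType k) (b : {biscalar M}).

Definition form_right (y x : M) : k^o := b x y.
Fact form_right_is_linear y : linear (form_right y).
Proof. by move=> a u v; rewrite /form_right linearPl. Qed.
HB.instance Definition _ y :=
  GRing.isLinear.Build k M k^o _ (form_right y) (form_right_is_linear y).

Definition form_dual (y : M) : dual M := linfun (form_right y).
Fact form_dual_is_linear : linear form_dual.
Proof.
move=> a u v; apply/lfunP => x.
by rewrite add_lfunE scale_lfunE !lfunE /= /form_right linearPr.
Qed.
HB.instance Definition _ :=
  GRing.isLinear.Build k M (dual M) _ form_dual form_dual_is_linear.

Hypothesis b_alt : forall x, b x x = 0.
Hypothesis b_nd : nondegenerate_form b.

Lemma form_altN x y : b x y = - b y x.
Proof.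
have := b_alt (x + y); rewrite linearDr !linearDl !b_alt add0r addr0.
by move/eqP; rewrite addr_eq0 => /eqP ->; rewrite opprK.
Qed.

Lemma riesz (l : dual M) : exists y, forall x, l x = b x y.
Proof.
have ker0 : lker (linfun form_dual) == 0%VS.
  apply/lker0P => x y; rewrite !lfunE /= => /lfunP exy.
  apply/eqP; rewrite -subr_eq0; apply/eqP/b_nd => z.
  have := exy z; rewrite !lfunE /= /form_right => e.
  by rewrite form_altN linearBr e subrr oppr0.
have : l \in limg (linfun form_dual).
  suff -> : limg (linfun form_dual) = fullv by rewrite memvf.
  apply/eqP; rewrite eqEdim subvf limg_dim_eq ?(eqP ker0) ?capv0 //.
  by rewrite !dimvf /dim /= muln1.
by case/memv_imgP=> y _ ->; exists y => x; rewrite !lfunE.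
Qed.
End Riesz.

Lemma separation (M : vectType k) (W : {vspace M}) x : x \notin W ->
  exists l : dual M, (forall w, w \in W -> l w = 0) /\ l x != 0.
Proof.
move=> xW; pose y := x - projv W x.
have y0 : y != 0 by apply: contra xW; rewrite subr_eq0 => /eqP ->; rewrite memv_proj.
have [i yi0] : exists i, coord (vbasis fullv) i y != 0.
  apply/existsP; apply: contraNT y0 => /existsPn h.
  rewrite [y](coord_vbasis (memvf _)); apply/eqP/big1 => i _.
  by move/negPn: (h i) => /eqP ->; rewrite scale0r.
pose pr : 'End(M) := (\1 - projv W)%VF.
exists (linfun (coord (vbasis (fullv : {vspace M})) i : M -> k^o) \o pr)%VF.
split=> [w wW|]; rewrite comp_lfunE lfunE /= add_lfunE opp_lfunE id_lfunE //.
by rewrite projv_id // subrr linear0.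
Qed.

End Duality.

Section HasseWitt.
Variables (k : fieldType) (p : nat).
Variables (hp : p \in [pchar k]) (hk : perfect_field k p).

Notation "{ 'frob' U -> V }" := {linear U%type -> V%type | pFrobenius_aut hp \; *:%R}
  (U at level 98, V at level 99, format "{ 'frob'  U  ->  V }").
Notation "{ 'frobV' U -> V }" := {linear U%type -> V%type | frobV hp hk \; *:%R}
  (U at level 98, V at level 99, format "{ 'frobV'  U  ->  V }").

Definition frob_ker (U V : vectType k) (f : {frob U -> V}) : {vspace U} :=
  semi_ker (frobV hp hk) f.

Lemma mem_frob_ker (U V : vectType k) (f : {frob U -> V}) x :
  (x \in frob_ker f) = (f x == 0).
Proof.
exact: (@mem_semi_ker k (pFrobenius_aut hp) (frobV hp hk)
          (frobK hp hk) (frobVK hp hk)).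
Qed.

Record dieudonne := Dieudonne {
  dm_sort :> vectType k;
  dm_F : {frob dm_sort -> dm_sort};
  dm_V : {frobV dm_sort -> dm_sort};
  dm_kerF : forall x, dm_F x = 0 <-> exists y, x = dm_V y;
  dm_kerV : forall x, dm_V x = 0 <-> exists y, x = dm_F y
}.

Arguments dm_F {d}.
Arguments dm_V {d}.

Record polDM := PolDM {
  pdm_dm :> dieudonne;
  pdm_form : {biscalar pdm_dm};
  pdm_alt : forall x, pdm_form x x = 0;
  pdm_nondeg : nondegenerate_form pdm_form;
  pdm_adj : forall x y, pdm_form (dm_F x) y = pdm_form x (dm_V y) ^+ p
}.

Arguments pdm_form {p}.

Definition polDM_iso (D1 D2 : polDM) : Prop :=
  exists f : 'Hom(D1, D2),
    [/\ bijective f,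
        forall x, f (dm_F x) = dm_F (f x),
        forall x, f (dm_V x) = dm_V (f x) &
        forall x y, pdm_form (f x) (f y) = pdm_form x y].

(* hw_inj and hw_img say that hw_Psi is a bijection from Ker(Phi) onto the
   annihilator of Image(Phi) in the dual of hw_sort. *)
Record hwTriple := HWTriple {
  hw_sort :> vectType k;
  hw_Phi : {frob hw_sort -> hw_sort};
  hw_Psi : {frob subvs_of (frob_ker hw_Phi) -> dual hw_sort};
  hw_inj : injective hw_Psi;
  hw_img : forall l : dual hw_sort,
    (exists x, l = hw_Psi x) <-> (forall q, l (hw_Phi q) = 0)
}.

Arguments hw_Phi {h}.
Arguments hw_Psi {h}.

Definition hw_iso (H1 H2 : hwTriple) : Prop :=
  exists f : 'Hom(H1, H2),
    [/\ bijective f,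
        forall q, hw_Phi (f q) = f (hw_Phi q) &
        forall (x1 : subvs_of (frob_ker (@hw_Phi H1)))
               (x2 : subvs_of (frob_ker (@hw_Phi H2))),
          vsval x2 = f (vsval x1) ->
          hw_Psi x2 = (dual_map f)^-1%VF (hw_Psi x1)].

Section ConstructionHW.
Variable D : polDM.
Local Notation F := (@dm_F D).
Local Notation V := (@dm_V D).
Local Notation b := (@pdm_form D).

Definition HW_sort : vectType k := quotv (frob_ker F).
Local Notation pi := (@qpi k D (frob_ker F)).

Lemma HW_F_repr x : F (repr (pi x)) = F x.
Proof.
have := repr_qpi (frob_ker F) x.
by rewrite mem_frob_ker linearB subr_eq0 => /eqP.
Qed.

(* repr q is a representative in D of the class q; HW_Phi_pi and HW_form_pi
   state independence of the representative. *)
Definition HW_Phi (q : HW_sort) : HW_sort := pi (F (repr q)).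

Lemma HW_Phi_pi x : HW_Phi (pi x) = pi (F x).
Proof. by rewrite /HW_Phi HW_F_repr. Qed.

Fact HW_Phi_is_linear : linear_for (pFrobenius_aut hp \; *:%R) HW_Phi.
Proof.
move=> a q r; rewrite -[q]reprqK -[r]reprqK -linearP !HW_Phi_pi.
by rewrite linearP [pi _]linearP.
Qed.
HB.instance Definition _ :=
  GRing.isLinear.Build k HW_sort HW_sort _ HW_Phi HW_Phi_is_linear.

Lemma ker_isotropic x y : F x = 0 -> F y = 0 -> b x y = 0.
Proof.
move=> Fx /dm_kerF[z ->]; apply/eqP; rewrite -(fmorph_eq0 (pFrobenius_aut hp)) /=.
by rewrite pFrobenius_autE -pdm_adj Fx linear0l.
Qed.

Lemma F_eq0 x : (forall y, b y (F x) = 0) -> F x = 0.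
Proof.
move=> h; apply: (pdm_nondeg (p := D)) => y.
by rewrite form_altN ?h ?oppr0 //; apply: pdm_alt.
Qed.

Local Notation K := (subvs_of (frob_ker HW_Phi)).

Lemma HW_FF (x : K) : F (F (repr (vsval x))) = 0.
Proof.
have := subvsP x; rewrite mem_frob_ker /= /HW_Phi qpi_eq0 mem_frob_ker.
by move/eqP.
Qed.

Definition HW_form (x : K) (q : HW_sort) : k^o := b (repr q) (F (repr (vsval x))).

Lemma HW_form_pi x y : HW_form x (pi y) = b y (F (repr (vsval x))).
Proof.
apply/eqP; rewrite -subr_eq0 -linearBl; apply/eqP/ker_isotropic; last exact: HW_FF.
by apply/eqP; rewrite -mem_frob_ker repr_qpi.
Qed.

Fact HW_form_is_linear x : linear (HW_form x).
Proof.
move=> a q r; rewrite -[q]reprqK -[r]reprqK -linearP !HW_form_pi.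
by rewrite linearPl.
Qed.
HB.instance Definition _ x :=
  GRing.isLinear.Build k HW_sort k^o _ (HW_form x) (HW_form_is_linear x).

Definition HW_Psi (x : K) : dual HW_sort := linfun (HW_form x).

Fact HW_Psi_is_linear : linear_for (pFrobenius_aut hp \; *:%R) HW_Psi.
Proof.
move=> a x y; apply/lfunP=> q; rewrite add_lfunE scale_lfunE !lfunE /= /HW_form.
have -> : vsval (a *: x + y) = pi (a *: repr (vsval x) + repr (vsval y)).
  by rewrite [pi _]linearP /= !reprqK.
by rewrite HW_F_repr linearP linearPr.
Qed.
HB.instance Definition _ :=
  GRing.isLinear.Build k K (dual HW_sort) _ HW_Psi HW_Psi_is_linear.

Fact HW_inj : injective HW_Psi.
Proof.
apply: raddf_inj => x /lfunP x0; apply: val_inj; rewrite /= -[vsval x]reprqK.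
apply/eqP; rewrite qpi_eq0 mem_frob_ker; apply/eqP/F_eq0 => y.
by have := x0 (pi y); rewrite !lfunE /= HW_form_pi.
Qed.

Fact HW_img (l : dual HW_sort) :
  (exists x, l = HW_Psi x) <-> (forall q, l (HW_Phi q) = 0).
Proof.
split=> [[x ->] q|l0].
  rewrite lfunE /= -[q]reprqK HW_Phi_pi HW_form_pi pdm_adj.
  have /dm_kerV -> : exists y, F (repr (vsval x)) = F y by eexists.
  by rewrite linear0r expr0n -(prednK (prime_gt0 (pcharf_prime hp))).
have [z lz] := riesz (@pdm_alt D) (@pdm_nondeg D) (l \o linfun pi)%VF.
have {}lz y : l (pi y) = b y z by rewrite -lz comp_lfunE lfunE.
have /dm_kerV[x zx] : V z = 0.
  apply: (pdm_nondeg (p := D)) => y; rewrite form_altN; last exact: pdm_alt.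
  apply/eqP; rewrite oppr_eq0 -(fmorph_eq0 (pFrobenius_aut hp)) /=.
  by rewrite pFrobenius_autE -pdm_adj -lz -HW_Phi_pi l0.
have xK : pi x \in frob_ker HW_Phi.
  rewrite mem_frob_ker /= HW_Phi_pi qpi_eq0 mem_frob_ker -zx; apply/eqP.
  rewrite zx; apply: F_eq0 => y; rewrite -zx.
  rewrite form_altN; last exact: pdm_alt.
  rewrite pdm_adj form_altN; last exact: pdm_alt.
  have /dm_kerF FV0 : exists w, V y = V w by eexists.
  have -> : b (V y) z = 0.
    by rewrite -lz; have/eqP := FV0; rewrite -mem_frob_ker -qpi_eq0 => /eqP->; rewrite linear0.
  by rewrite oppr0 expr0n -(prednK (prime_gt0 (pcharf_prime hp))) oppr0.
exists (Subvs xK); apply/lfunP=> q; rewrite lfunE /= -[q]reprqK HW_form_pi lz.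
by rewrite /= HW_F_repr zx.
Qed.

Definition HW : hwTriple := HWTriple HW_inj HW_img.

End ConstructionHW.
Section ConstructionDM.
Variables (H : hwTriple) (R0 : {vspace H}).
Local Notation Phi := (@hw_Phi H).
Local Notation Psi := (@hw_Psi H).
Local Notation R1 := (frob_ker Phi).
Local Notation M := (H * dual H)%type.
Hypothesis R0P : complement R1 R0.

Definition DM_form (x y : M) : k := y.2 x.1 - x.2 y.1.

Fact DM_form_is_bilinear : bilinear_for *%R *%R DM_form.
Proof.
have e (a c d c' d' : k) : a * c + d - (a * c' + d') = a * (c - c') + (d - d').
  by rewrite mulrBr opprD addrACA.
split=> [y|x] a u v; rewrite /DM_form /= add_lfunE scale_lfunE.
  by rewrite (linearP y.2) -e.
by rewrite (linearP x.2) -e.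
Qed.
HB.instance Definition _ :=
  bilinear_isBilinear.Build k M M k *%R *%R DM_form DM_form_is_bilinear.

Lemma DM_alt x : DM_form x x = 0.
Proof. exact: subrr. Qed.

Lemma DM_nondeg : nondegenerate_form DM_form.
Proof.
case=> q l h; have l0 : l = 0.
  apply/lfunP=> y; have := h (y, 0); rewrite /DM_form /= !zero_lfunE sub0r.
  by move/eqP; rewrite oppr_eq0 => /eqP.
have q0 : q = 0.
  apply/eqP/negPn/negP=> qn0.
  have [|m [_ /negP]] := @separation k H 0%VS q; first by rewrite memv0.
  by apply; have := h (0, m); rewrite /DM_form /= linear0 subr0 => ->.
by rewrite l0 q0.
Qed.

(* daddv_pi R0 R1 and daddv_pi R1 R0 are the two projections attached to the
   decomposition of H as the direct sum of R0 and R1. *)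
Definition DM_F of complement R1 R0 := fun x : M =>
  (Phi (daddv_pi R0 R1 x.1), Psi (vsproj R1 (daddv_pi R1 R0 x.1))) : M.

Local Notation F := (DM_F R0P).

Fact DM_F_is_linear : linear_for (pFrobenius_aut hp \; *:%R) F.
Proof. by move=> a x y; rewrite /DM_F /= !linearP. Qed.
HB.instance Definition _ := GRing.isLinear.Build k M M _ F DM_F_is_linear.

Definition DM_V_form (y : M) (q : H) : k^o := frobV hp hk (DM_form (F (q, 0)) y).
Fact DM_V_form_is_linear y : linear (DM_V_form y).
Proof.
move=> a q r; rewrite /DM_V_form.
have -> : (a *: q + r, 0) = a *: (q, 0) + (r, 0) :> M.
  by congr pair; rewrite /= scaler0 addr0.
by rewrite linearP linearPl rmorphD rmorphM /= frobK.
Qed.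
HB.instance Definition _ y :=
  GRing.isLinear.Build k H k^o _ (DM_V_form y) (DM_V_form_is_linear y).

(* The solution of b (F x) y = (b x (V y)) ^+ p, see DM_adj and DM_V_unique. *)
Definition DM_V of complement R1 R0 := fun y : M => (0, linfun (DM_V_form y)) : M.
Local Notation V := (DM_V R0P).

Lemma DM_adj x y : DM_form (F x) y = DM_form x (V y) ^+ p.
Proof.
rewrite {2}/DM_form /= linear0 subr0 lfunE /= /DM_V_form.
by rewrite -(pFrobenius_autE hp) frobVK.
Qed.

Lemma DM_V_unique (V' : M -> M) :
  (forall x y, DM_form (F x) y = DM_form x (V' y) ^+ p) -> V' =1 V.
Proof.
move=> h y; apply/eqP; rewrite -subr_eq0; apply/eqP/DM_nondeg => x.
rewrite form_altN ?linearBr; last exact: DM_alt.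
apply/eqP; rewrite oppr_eq0 subr_eq0; apply/eqP.
apply: (fmorph_inj (pFrobenius_aut hp)).
by rewrite /= !pFrobenius_autE -h DM_adj.
Qed.

Fact DM_V_is_linear : linear_for (frobV hp hk \; *:%R) V.
Proof.
move=> a x y; congr pair; first by rewrite /= scaler0 addr0.
apply/lfunP=> q; rewrite /= add_lfunE scale_lfunE !lfunE /= /DM_V_form.
by rewrite linearPr rmorphD rmorphM.
Qed.
HB.instance Definition _ := GRing.isLinear.Build k M M _ V DM_V_is_linear.

Let dR01 : (R0 :&: R1 = 0)%VS. Proof. by rewrite capvC; case: R0P. Qed.
Let dR10 : (R1 :&: R0 = 0)%VS. Proof. by case: R0P. Qed.
Let inR q : (q \in R1 + R0)%VS. Proof. by case: R0P => _ ->; rewrite memvf. Qed.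
Let r01 q : daddv_pi R0 R1 q + daddv_pi R1 R0 q = q.
Proof. by rewrite addrC daddv_pi_add. Qed.
Let pi0 u v : u \in R0 -> v \in R1 -> daddv_pi R0 R1 (u + v) = u.
Proof.
move=> uR vR; have := r01 (u + v) => /eqP.
rewrite -subr_eq0 opprD addrACA addr_eq0 => /eqP e.
have : daddv_pi R0 R1 (u + v) - u \in (R0 :&: R1)%VS.
  by rewrite memv_cap rpredB ?memv_pi //= e rpredN rpredB ?memv_pi.
by rewrite dR01 memv0 subr_eq0 => /eqP.
Qed.
Let pi1 u v : u \in R0 -> v \in R1 -> daddv_pi R1 R0 (u + v) = v.
Proof.
move=> uR vR; have := r01 (u + v); rewrite pi0 // => /addrI; exact.
Qed.

Let Phi_r0 q : Phi (daddv_pi R0 R1 q) = Phi q.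
Proof.
rewrite -[q in RHS]r01 linearD.
by have := memv_pi R1 R0 q; rewrite mem_frob_ker => /eqP ->; rewrite addr0.
Qed.

Let FE (u v : H) l (uR : u \in R0) (vR : v \in R1) :
  F (u + v, l) = (Phi u, Psi (Subvs vR)).
Proof. by rewrite /DM_F /= pi0 // pi1 // -SubvsE. Qed.

Let F0 x : F x = 0 <-> x.1 = 0.
Proof.
split=> [[e1 e2]|e]; last by rewrite /DM_F e !linear0.
rewrite -[x.1]r01.
have -> : daddv_pi R1 R0 x.1 = 0.
  have : vsproj R1 (daddv_pi R1 R0 x.1) = 0 by apply: hw_inj; rewrite e2 linear0.
  by move/(congr1 vsval); rewrite vsprojK ?memv_pi.
suff : daddv_pi R0 R1 x.1 \in (R0 :&: R1)%VS.
  by rewrite dR01 memv0 => /eqP ->; rewrite addr0.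
by rewrite memv_cap memv_pi mem_frob_ker e1 eqxx.
Qed.

Fact DM_kerF x : F x = 0 <-> exists y, x = V y.
Proof.
split=> [/F0 x1|[y ->]]; last exact/F0.
pose W := semi_img (pFrobenius_aut hp) V.
have memW := @mem_semi_img k (frobV hp hk) (pFrobenius_aut hp)
               (frobVK hp hk) (frobK hp hk) _ _ V.
case: (boolP (x \in W)) => [/memW //|].
case/separation=> l [lW /negP []].
have [y ly] := riesz DM_alt DM_nondeg l.
have Fy : F y = 0.
  apply: DM_nondeg => z; rewrite DM_adj form_altN; last exact: DM_alt.
  have e : DM_form (V z) y = 0 by rewrite -ly lW //; apply/memW; exists z.
  by rewrite /= e oppr0 expr0n -(prednK (prime_gt0 (pcharf_prime hp))).
have /F0 y1 := Fy.
by rewrite ly /= /DM_form x1 y1 !linear0 addr0.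
Qed.

Fact DM_kerV x : V x = 0 <-> exists y, x = F y.
Proof.
have V0 z : V z = 0 <-> forall y, DM_form (F y) z = 0.
  split=> [Vz y|h].
    rewrite DM_adj Vz /DM_form /= linear0 zero_lfunE subrr.
    by rewrite expr0n -(prednK (prime_gt0 (pcharf_prime hp))).
  by congr pair; apply/lfunP=> q; rewrite lfunE /= /DM_V_form h rmorph0 zero_lfunE.
have FV (u v : H) l (uR : u \in R0) (vR : v \in R1) y :
  DM_form (F (u + v, l)) y = y.2 (Phi u) - Psi (Subvs vR) y.1 by rewrite FE.
split=> [/V0 h|[y ->]]; last first.
  apply/V0 => z; rewrite /DM_form /DM_F /=.
  set a := vsproj _ _; set c := vsproj _ _.
  have /hw_img -> : exists x, Psi a = Psi x by exists a.
  have /hw_img -> : exists x, Psi c = Psi x by exists c.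
  by rewrite subrr.
have x2 q : x.2 (Phi q) = 0.
  have := h (daddv_pi R0 R1 q + 0, 0); rewrite (FV _ _ _ _ (mem0v _)) ?memv_pi //.
  have -> : Subvs (mem0v R1) = 0 by apply: val_inj.
  by rewrite linear0 zero_lfunE subr0 Phi_r0.
have /hw_img[r xr] := x2.
pose W := semi_img (frobV hp hk) Phi.
have memW := @mem_semi_img k (pFrobenius_aut hp) (frobV hp hk)
               (frobK hp hk) (frobVK hp hk) _ _ Phi.
have /memW[q xq] : x.1 \in W.
  apply: contraT => /separation[l [lW /negP []]].
  have /hw_img[s ls] : forall q, l (Phi q) = 0.
    by move=> q; apply: lW; apply/memW; exists q.
  have := h (0 + vsval s, 0); rewrite (FV _ _ _ (mem0v _) (subvsP s)) linear0 linear0.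
  have -> : Subvs (subvsP s) = s by apply: val_inj.
  by rewrite -ls sub0r => /eqP; rewrite oppr_eq0.
exists (daddv_pi R0 R1 q + vsval r, 0); rewrite (FE _ _ (subvsP r)) ?memv_pi //.
have -> : Subvs (subvsP r) = r by apply: val_inj.
by rewrite Phi_r0 -xq -xr; case: (x).
Qed.

Definition DM : polDM :=
  @PolDM (Dieudonne DM_kerF DM_kerV) DM_form DM_alt DM_nondeg DM_adj.

End ConstructionDM.

End HasseWitt.

Arguments dm_F {k p hp hk d}.
Arguments dm_V {k p hp hk d}.
Arguments pdm_form {k p hp hk _}.
Arguments hw_Phi {k p hp hk h}.
Arguments hw_Psi {k p hp hk h}.

(* The isomorphism classes of the objects satisfying A. *)
Definition iso_class (T : Type) (iso : T -> T -> Prop) (A : T -> Prop) : Type :=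
  {C : T -> Prop | exists x, A x /\ C = iso x}.

Definition in_class (T : Type) (iso : T -> T -> Prop) (A : T -> Prop)
    (x : T) (C : iso_class iso A) : Prop := sval C x.

Section Classes.
Variables (k : fieldType) (p : nat).
Variables (hp : p \in [pchar k]) (hk : perfect_field k p).

Definition polDM_classes (n : nat) : Type :=
  iso_class (@polDM_iso k p hp hk) (fun D => \dim (fullv : {vspace D}) = n).

Definition hw_classes (n : nat) : Type :=
  iso_class (@hw_iso k p hp hk) (fun H => \dim (fullv : {vspace H}) = n).
End Classes.

(* Main.v *)
Require Import Defs.
From HB Require Import structures.
From mathcomp Require Import all_boot all_order all_algebra.
From mathcomp Require Import boolp ring.

Set Implicit Arguments.
Unset Strict Implicit.
Unset Printing Implicit Defensive.

Import GRing.Theory.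
Local Open Scope ring_scope.

(** The Hasse-Witt triple of a polarized Dieudonne module D keeps only the
    quotient D / Ker F.  Nothing is lost, because D is a symplectic space in
    which Ker F is Lagrangian: D is determined, as a symplectic space, by the
    quotient Q = D / Ker F, and V is determined by F and the form.  What must be
    recovered is F, and for this it is enough to split the projection r from D
    to Q by a section s compatible with F.

    Both constructions are compared through the notion [hw_quotient] of a
    presentation of a triple H as a quotient of D, a surjection r with kernel
    Ker F that carries F to Phi and computes Psi from the form.  Such an r exists
    exactly when H is isomorphic to HW D ([hw_isoE]), and the first projection is
    one for DM H ([DM_hw_quotient]).

    The heart of the proof is [hw_quotient_DM]: a presentation of H by D yields
    D ~ DM H, for any choice of the complement R0 of Ker Phi.  One needs a section
    s of r with isotropic image and with s (Phi q) = F (s q) for q in R0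
    ([isotropic_section]); then x |-> (r x, b (s -, x)) is the isomorphism.  The
    second condition prescribes s on the image of Phi, where F (s q) does not
    depend on s because s is defined up to Ker F.  The values prescribed there lie
    in the image of F, which is isotropic.  Any section s1 with these values is
    then made isotropic by a correction with values in Ker F ~ Q^*, that is, by a
    map a : Q -> Q^*.  Isotropy requires a x y - a y x to be the alternating form
    induced by s1, and compatibility with F requires a to vanish on the image of
    Phi; both can be achieved since the alternating form vanishes on that image
    ([altern_skew_vanish], valid in every characteristic, 2 included).

    It follows that HW D ~ HW D' iff D ~ D', and DM H ~ D iff H ~ HW D, which is
    the bijection on isomorphism classes; the dimensions agree because
    dim (H + H^* ) = 2 dim H. *)

(** * Linear and semilinear algebra *)

Section LinearAlgebra.
Variable k : fieldType.

Lemma surj_section (U V : vectType k) (f : 'Hom(U, V)) :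
  (forall y, exists x, f x = y) -> cancel (f^-1)%VF f.
Proof.
by move=> f_surj y; have [x <-] := f_surj y; rewrite limg_lfunVK // memv_img ?memvf.
Qed.

Lemma lfun_bij (U V : vectType k) (f : 'Hom(U, V)) :
  injective f -> (forall y, exists x, f x = y) -> bijective f.
Proof.
move=> f_inj f_surj; exists (f^-1)%VF; last exact: surj_section.
by apply/lker0_lfunK/lker0P.
Qed.

Lemma bij_lker0 (U V : vectType k) (f : 'Hom(U, V)) :
  bijective f -> lker f == 0%VS.
Proof. by move/bij_inj => f_inj; apply/lker0P. Qed.

Lemma bij_lfunVK (U V : vectType k) (f : 'Hom(U, V)) :
  bijective f -> cancel (f^-1)%VF f.
Proof.
by case=> g _ gK; apply: surj_section => y; exists (g y).
Qed.

Lemma lfun_inv_bij (U V : vectType k) (f : 'Hom(U, V)) :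
  bijective f -> bijective (f^-1)%VF.
Proof.
by move=> fb; exists f; [exact: bij_lfunVK | exact/lker0_lfunK/bij_lker0].
Qed.

Lemma lfun_bij_dim (U V : vectType k) (f : 'Hom(U, V)) :
  bijective f -> \dim (fullv : {vspace U}) = \dim (fullv : {vspace V}).
Proof.
move=> fb; rewrite -(limg_dim_eq (f := f) (U := fullv)).
  congr (\dim _); apply/eqP; rewrite eqEsubv subvf; apply/subvP => y _.
  by rewrite -[y](bij_lfunVK fb) memv_img ?memvf.
by rewrite (eqP (bij_lker0 fb)) capv0.
Qed.

Lemma dual_mapE (U V : vectType k) (f : 'Hom(U, V)) (l : dual V) x :
  dual_map f l x = l (f x).
Proof. by rewrite lfunE /= comp_lfunE. Qed.

Lemma dual_map_bij (U V : vectType k) (f : 'Hom(U, V)) :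
  bijective f -> bijective (dual_map f).
Proof.
move=> fb; exists (dual_map (f^-1)%VF) => l; apply/lfunP => x; rewrite !dual_mapE.
  by rewrite bij_lfunVK.
by rewrite lker0_lfunK // bij_lker0.
Qed.

(** A semilinear phi becomes linear after twisting the coordinates of its source;
    as s is invertible, this changes neither the image nor, up to the twist, the
    kernel, and a linear partial inverse of phi can be used. *)
Lemma semilinear_factor (s t : {rmorphism k -> k}) (sK : cancel s t) (tK : cancel t s)
    (U V W : vectType k)
    (phi : {linear U -> V | s \; *:%R}) (psi : {linear U -> W | s \; *:%R}) :
  (forall x, phi x = 0 -> psi x = 0) ->
  exists h : 'Hom(V, W), forall x, h (phi x) = psi x.
Proof.
move=> ker_le.
pose phi' : 'Hom(U, V) := linfun (untwist t phi).
pose psi' : 'Hom(U, W) := linfun (untwist t psi).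
have phi'E y : phi' y = phi (twist t y) by rewrite lfunE.
have psi'E y : psi' y = psi (twist t y) by rewrite lfunE.
exists (psi' \o phi'^-1)%VF => x.
rewrite comp_lfunE -[x in RHS](twistK sK) -psi'E.
apply/eqP; rewrite -subr_eq0 -(linearB psi') /= psi'E; apply/eqP/ker_le.
rewrite -phi'E linearB /= limg_lfunVK ?phi'E ?twistK ?subrr //.
by rewrite -[x in phi x](twistK sK) -phi'E memv_img ?memvf.
Qed.

Lemma altern_opp (U : vectType k) (A : 'Hom(U, dual U)) :
  (forall x, A x x = 0) -> forall x y, A x y = - A y x.
Proof.
move=> A_alt x y; have := A_alt (x + y).
rewrite !(linearD A) /= !add_lfunE !linearD /= !A_alt add0r addr0 addrC => /eqP.
by rewrite addrC addr_eq0 => /eqP.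
Qed.

(** In a basis, keep the strictly lower triangular part of the Gram matrix of A:
    this halves A without dividing by 2. *)
Lemma altern_skew (U : vectType k) (A : 'Hom(U, dual U)) :
  (forall x, A x x = 0) ->
  exists a : 'Hom(U, dual U), forall x y, a x y - a y x = A x y.
Proof.
move=> A_alt; pose e := vbasis (fullv : {vspace U}).
pose c i : dual U := linfun (coord e i : U -> k^o).
have cE i x : c i x = coord e i x by rewrite lfunE.
pose I := 'I_(\dim (fullv : {vspace U})).
pose m (i : I) : dual U := \sum_(j : I | (j < i)%N) A e`_i e`_j *: c j.
pose a0 x : dual U := \sum_i coord e i x *: m i.
have a0_lin : linear a0.
  move=> r u v; rewrite /a0 scaler_sumr -big_split /=.
  by apply: eq_bigr => i _; rewrite linearP /= scalerDl scalerA.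
pose a1 : {linear U -> dual U} := HB.pack a0
  (GRing.isLinear.Build k U (dual U) _ _ a0_lin).
exists (linfun a1) => x y.
have a0E u v : a0 u v =
    \sum_(i : I) \sum_(j : I)
      (if (j < i)%N then coord e i u * coord e j v * A e`_i e`_j else 0).
  rewrite sum_lfunE; apply: eq_bigr => i _; rewrite scale_lfunE sum_lfunE scaler_sumr.
  rewrite big_mkcond; apply: eq_bigr => j _; case: ifP => // _.
  by rewrite scale_lfunE cE -mulrA [coord e j v * _]mulrC.
have AE : A x y = \sum_(i : I) \sum_(j : I) coord e i x * coord e j y * A e`_i e`_j.
  rewrite {1}[x](coord_vbasis (memvf x)) (linear_sum A) /= sum_lfunE.
  apply: eq_bigr => i _; rewrite linearZ /= scale_lfunE.
  rewrite {1}[y](coord_vbasis (memvf y)) linear_sum scaler_sumr.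
  by apply: eq_bigr => j _; rewrite linearZ /= -mulrA.
rewrite !lfunE /= !a0E AE [X in _ - X]exchange_big /= -sumrB; apply: eq_bigr => i _.
rewrite -sumrB; apply: eq_bigr => j _; case: (ltngtP i j) => [lt_ij|lt_ji|/val_inj->].
- by rewrite sub0r [A e`_i _]altern_opp // mulrN [coord e j y * _]mulrC.
- by rewrite subr0.
- by rewrite subrr A_alt mulr0.
Qed.

(** Let P project onto W and Q = 1 - P.  Since A vanishes on W, A x y is the sum
    of A (Q x) (P y), its skew counterpart and A (Q x) (Q y); only the last term
    needs the previous lemma, and every term of the result factors through Q in
    the first variable. *)
Lemma altern_skew_vanish (U : vectType k) (A : 'Hom(U, dual U)) (W : {vspace U}) :
    (forall x, A x x = 0) -> {in W &, forall x y, A x y = 0} ->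
  exists2 a : 'Hom(U, dual U), {in W, forall w, a w = 0} &
    forall x y, a x y - a y x = A x y.
Proof.
move=> A_alt AW; have [a aE] := altern_skew A_alt.
have [P [Q [PQ PW QW]]] : exists P Q : 'End(U),
    [/\ forall x, x = P x + Q x, forall x, P x \in W & {in W, forall w, Q w = 0}].
  exists (projv W), (\1 - projv W)%VF; split=> [x|x|w wW].
  - by rewrite add_lfunE opp_lfunE id_lfunE subrKC.
  - exact: memv_proj.
  - by rewrite add_lfunE opp_lfunE id_lfunE projv_id // subrr.
pose c : 'Hom(U, dual U) := (dual_map P \o (A \o Q))%VF + (dual_map Q \o (a \o Q))%VF.
have cE u v : c u v = A (Q u) (P v) + a (Q u) (Q v).
  by rewrite /c 2!add_lfunE !comp_lfunE !dual_mapE.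
exists c => [w wW|x y].
  by rewrite add_lfunE !comp_lfunE QW // !linear0 addr0.
rewrite !cE opprD addrACA aE -(altern_opp A_alt).
rewrite [in RHS](PQ x) [in RHS](PQ y) (linearD A) /= add_lfunE !linearD /= (AW (P x) (P y)) //.
by rewrite add0r addrCA addrA.
Qed.

Lemma complement_pi (U V : vectType k) (s : {rmorphism k -> k})
    (phi : {linear U -> V | s \; *:%R}) (R1 R0 : {vspace U}) :
    complement R1 R0 -> {in R1, forall q, phi q = 0} ->
  forall q, phi (daddv_pi R0 R1 q) = phi q.
Proof.
case=> R10 R1D phi0 q.
have {2}<- : daddv_pi R1 R0 q + daddv_pi R0 R1 q = q.
  by rewrite daddv_pi_add // R1D memvf.
by rewrite linearD /= (phi0 (daddv_pi R1 R0 q)) ?add0r ?memv_pi.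
Qed.

End LinearAlgebra.

(** * Presentations of a Hasse-Witt triple *)

Section Presentation.
Variables (k : fieldType) (p : nat).
Variables (hp : p \in [pchar k]) (hk : perfect_field k p).
Local Notation polDM := (polDM hp hk).
Local Notation hwTriple := (hwTriple hp hk).
Implicit Types (D : polDM) (H : hwTriple).

(** The characterization of HW D by the projection from D, up to isomorphism and
    without reference to the quotient type. *)
Definition hw_quotient D H (r : 'Hom(D, H)) : Prop :=
  [/\ forall q, exists x, r x = q,
      forall x, r x = 0 <-> dm_F x = 0,
      forall x, r (dm_F x) = hw_Phi (r x) &
      forall (c : subvs_of (frob_ker hk (hw_Phi (h := H)))) x y,
        r x = vsval c -> hw_Psi c (r y) = pdm_form y (dm_F x)].

Lemma pdm_formN D (x y : D) : pdm_form x y = - pdm_form y x.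
Proof. by apply: form_altN; apply: pdm_alt. Qed.

(** b (F x, F y) = b (x, V (F y))^p and V F = 0. *)
Lemma form_FF D (x y : D) : pdm_form (dm_F x) (dm_F y) = 0.
Proof.
have /dm_kerV F0 : exists z, dm_F y = dm_F z by exists y.
by rewrite pdm_adj F0 linear0r -pFrobenius_autE rmorph0.
Qed.

(** Ker F contains its orthogonal, because Ker F is the image of V and V is
    adjoint to F. *)
Lemma ker_lagrangian D (y : D) :
  (forall x, dm_F x = 0 -> pdm_form x y = 0) -> dm_F y = 0.
Proof.
move=> y_ort; apply: pdm_nondeg => x.
have /dm_kerF FV0 : exists z, dm_V x = dm_V z by exists x.
by rewrite pdm_adj pdm_formN y_ort // oppr0 -pFrobenius_autE rmorph0.
Qed.

(** As Ker F is Lagrangian, the form identifies it with the dual of the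
    quotient. *)
Lemma hw_quotient_riesz D H (r : 'Hom(D, H)) : hw_quotient r ->
  exists kap : 'Hom(dual H, D),
    (forall l, r (kap l) = 0) /\ (forall l x, pdm_form x (kap l) = l (r x)).
Proof.
case=> _ r0 _ _; pose fd : 'Hom(D, dual D) := linfun (form_dual (@pdm_form _ _ _ _ D)).
have fdE x y : fd y x = pdm_form x y by rewrite !lfunE.
have fd_surj l : exists y, fd y = l.
  have [y yP] := riesz (@pdm_alt _ _ _ _ D) (@pdm_nondeg _ _ _ _ D) l.
  by exists y; apply/lfunP => x; rewrite fdE yP.
pose kap := (fd^-1 \o dual_map r)%VF.
have kapE l x : pdm_form x (kap l) = l (r x).
  by rewrite -fdE comp_lfunE surj_section // dual_mapE.
exists kap; split=> // l; apply/r0/ker_lagrangian => x /r0 rx0.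
by rewrite kapE rx0 linear0.
Qed.

(** The value prescribed at Phi q is F of a lift of the R0-component of q, which is well defined because Phi is injective on R0.  The section is
    then extended arbitrarily, and corrected into an isotropic one by values in Ker F
    without changing it on the image of Phi. *)
Lemma isotropic_section D H (r : 'Hom(D, H)) (R0 : {vspace H}) :
    complement (frob_ker hk (hw_Phi (h := H))) R0 -> hw_quotient r ->
  exists s : 'Hom(H, D), [/\ cancel s r,
    forall q q', pdm_form (s q) (s q') = 0 &
    {in R0, forall q, s (hw_Phi q) = dm_F (s q)}].
Proof.
move=> R0P rP; have [r_surj r0 rF rPsi] := rP.
pose R1 := frob_ker hk (hw_Phi (h := H)); pose pi0 := daddv_pi R0 R1.
have pi0R q : pi0 q \in R0 by exact: memv_pi.
have PhiR q : hw_Phi (pi0 q) = hw_Phi q.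
  by apply: (complement_pi R0P) => x; rewrite mem_frob_ker => /eqP.
pose s0 := (r^-1)%VF; have s0K : cancel s0 r by exact: surj_section.
have rFs q : r (dm_F (s0 q)) = hw_Phi q by rewrite rF s0K.
pose psi : {linear H -> D | pFrobenius_aut hp \; *:%R} := dm_F \o (s0 \o pi0)%VF.
have psiE q : psi q = dm_F (s0 (pi0 q)) by rewrite /= comp_lfunE.
have [|h hE] := semilinear_factor (frobK hp hk) (frobVK hp hk) (phi := hw_Phi) (psi := psi).
  move=> q q0; rewrite psiE (_ : pi0 q = 0) ?linear0 //.
  apply/eqP; rewrite -memv0; case: R0P => <- _.
  by rewrite memv_cap pi0R mem_frob_ker PhiR q0 eqxx.
pose W := semi_img (frobV hp hk) (hw_Phi (h := H)).
have memW := mem_semi_img (frobK hp hk) (frobVK hp hk) (hw_Phi (h := H)).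
(* On W, s1 is the prescribed map h; on a complement, the arbitrary section s0. *)
pose s1 : 'Hom(H, D) := (h \o projv W)%VF + (s0 \o (\1 - projv W))%VF.
have s1E q : s1 q = h (projv W q) + s0 (q - projv W q).
  by rewrite add_lfunE !comp_lfunE add_lfunE opp_lfunE id_lfunE.
have s1Phi q : s1 (hw_Phi q) = dm_F (s0 (pi0 q)).
  have PhiW : hw_Phi q \in W by apply/memW; exists q.
  by rewrite s1E projv_id // subrr linear0 addr0 hE psiE.
have s1K : cancel s1 r.
  move=> q; rewrite s1E linearD /= s0K.
  have /memW[q' ->] : projv W q \in W by exact: memv_proj.
  by rewrite hE psiE rFs PhiR subrKC.
(* A is the pullback by s1 of the form, the defect of isotropy of s1. *)
pose A : 'Hom(H, dual H) :=
  (dual_map s1 \o (linfun (form_dual (@pdm_form _ _ _ _ D)) \o s1))%VF.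
have AE q q' : A q q' = pdm_form (s1 q') (s1 q).
  by rewrite !comp_lfunE dual_mapE !lfunE.
have [q|q q' /memW[u ->] /memW[v ->]|a aW aE] := @altern_skew_vanish k H A W.
- by rewrite AE pdm_alt.
- by rewrite AE !s1Phi form_FF.
have [kap [rkap kapE]] := hw_quotient_riesz rP.
have kap_iso l m : pdm_form (kap l) (kap m) = 0 by rewrite kapE rkap linear0.
pose s : 'Hom(H, D) := s1 - (kap \o a)%VF.
have sE q : s q = s1 q - kap (a q) by rewrite add_lfunE opp_lfunE comp_lfunE.
have sK : cancel s r by move=> q; rewrite sE linearB /= s1K rkap subr0.
exists s; split=> // [q q'|q qR].
  rewrite !sE linearBl !linearBr /= kap_iso kapE s1K -AE.
  by rewrite pdm_formN kapE s1K -aE; ring.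
have PhiW : hw_Phi q \in W by apply/memW; exists q.
rewrite sE s1Phi aW // linear0 subr0.
(* F (s0 q) = F (s q), because s0 q and s q have the same image q under r. *)
apply/eqP; rewrite -subr_eq0 -linearB; apply/eqP/r0; rewrite linearB /= s0K sK.
by apply/eqP; rewrite subr_eq0; apply/eqP/daddv_pi_id; rewrite // capvC; case: R0P.
Qed.

(** Compatibility with V is automatic, V being the adjoint of F. *)
Lemma polDM_iso_of_F (D1 D2 : polDM) (f : 'Hom(D1, D2)) :
    bijective f -> (forall x, f (dm_F x) = dm_F (f x)) ->
    (forall x y, pdm_form (f x) (f y) = pdm_form x y) ->
  polDM_iso D1 D2.
Proof.
move=> fb fF fform; exists f; split=> // y.
apply/eqP; rewrite -subr_eq0; apply/eqP/pdm_nondeg => x.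
have [f' _ f'K] := fb; rewrite pdm_formN linearBr /= -[x]f'K fform.
apply/eqP; rewrite oppr_eq0 subr_eq0 -(inj_eq (fmorph_inj (pFrobenius_aut hp))).
by rewrite /= !pFrobenius_autE -!pdm_adj -fF fform.
Qed.

(** An isotropic section s splits D as the sum of s (H) and Ker F ~ H^*, both
    Lagrangian.  The coordinate of x in H^* is b (s -, x), since s (H) is
    orthogonal to itself.  On F x, with r x = q0 + q1, it only sees F (s q1),
    which is Psi q1, because F (s q0) = s (Phi q0) lies in s (H). *)
Lemma hw_quotient_DM D H (r : 'Hom(D, H)) (R0 : {vspace H})
    (R0P : complement (frob_ker hk (hw_Phi (h := H))) R0) :
  hw_quotient r -> polDM_iso D (DM R0P).
Proof.
move=> rP; have [r_surj r0 rF rPsi] := rP; have [R10 R1D] := R0P.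
have [s [sK s_iso sPhi]] := isotropic_section R0P rP.
pose l : 'Hom(D, dual H) :=
  (dual_map s \o linfun (form_dual (@pdm_form _ _ _ _ D)))%VF.
have lE x q : l x q = pdm_form (s q) x by rewrite comp_lfunE dual_mapE !lfunE.
pose g x : (H * dual H)%type := (r x, l x).
have g_lin : linear g by move=> c x y; rewrite /g !linearP.
pose g' : {linear D -> DM R0P} := HB.pack g
  (GRing.isLinear.Build k D (DM R0P) _ _ g_lin).
have gE x : linfun g' x = g x by rewrite lfunE.
have g_form x y : DM_form (g x) (g y) = pdm_form x y.
  rewrite /DM_form /= !lE.
  have isoK u v : r u = 0 -> r v = 0 -> pdm_form u v = 0.
    by move=> /r0 ? /r0 ?; apply: ker_isotropic.
  (* x - s (r x) and y - s (r y) lie in Ker F, which is isotropic. *)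
  have r_diff z : r (z - s (r z)) = 0 by rewrite linearB /= sK subrr.
  have /eqP := isoK _ _ (r_diff x) (r_diff y).
  rewrite linearBl !linearBr /= s_iso subr0.
  by rewrite (pdm_formN x (s _)) opprK subr_eq0 => /eqP <-; rewrite addrK.
apply: (@polDM_iso_of_F _ _ (linfun g')) => [|x|x y]; last by rewrite /= !gE g_form.
  apply: lfun_bij => [x y|[q m]]; rewrite ?gE.
    move=> gxy; apply/eqP; rewrite -subr_eq0; apply/eqP/pdm_nondeg => z.
    have g0 : g (x - y) = 0 by rewrite -gE linearB /= !gE gxy subrr.
    by rewrite -g_form g0 /DM_form /= linear0 zero_lfunE subrr.
  have [kap [rkap kapE]] := hw_quotient_riesz rP.
  exists (s q + kap m); rewrite gE /g linearD /= sK rkap addr0; congr pair.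
  by apply/lfunP => q'; rewrite lE linearDr /= s_iso add0r kapE sK.
rewrite !gE /= /g /DM_F /=.
pose R1 := frob_ker hk (hw_Phi (h := H)).
rewrite -/R1; set q0 := daddv_pi R0 R1 (r x); set q1 := daddv_pi R1 R0 (r x).
have Phi_q0 : hw_Phi q0 = hw_Phi (r x).
  by apply: (complement_pi R0P) => y; rewrite mem_frob_ker => /eqP.
have q01 : r x = q0 + q1.
  by rewrite addrC daddv_pi_add ?R1D ?memvf.
congr pair; first by rewrite Phi_q0 rF.
have Fx : dm_F x = s (hw_Phi q0) + dm_F (s q1).
  rewrite sPhi ?memv_pi // -linearD -linearD -q01 /=.
  apply/eqP; rewrite -subr_eq0 -linearB; apply/eqP/r0.
  by rewrite linearB /= sK subrr.
apply/lfunP => q; rewrite lE Fx linearDr /= s_iso add0r.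
by rewrite -(rPsi (vsproj R1 q1)) ?sK // vsprojK ?memv_pi.
Qed.

Lemma DM_hw_quotient H (R0 : {vspace H})
    (R0P : complement (frob_ker hk (hw_Phi (h := H))) R0) :
  exists r : 'Hom(DM R0P, H), hw_quotient r.
Proof.
pose R1 := frob_ker hk (hw_Phi (h := H)).
pose r : 'Hom(DM R0P, H) := linfun (fst : (H * dual H)%type -> H).
have rE x : r x = x.1 by rewrite lfunE.
have Phi_pi q : hw_Phi (daddv_pi R0 R1 q) = hw_Phi q.
  by apply: (complement_pi R0P) => y; rewrite mem_frob_ker => /eqP.
have [R10 R1D] := R0P.
have r0 x : r x = 0 <-> dm_F x = 0.
  rewrite rE /= /DM_F; split=> [->|[Phi0 Psi0]]; first by rewrite !linear0.
  rewrite -[x.1](daddv_pi_add R10) ?R1D ?memvf //.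
  have -> : daddv_pi R1 R0 x.1 = 0.
    have : vsproj R1 (daddv_pi R1 R0 x.1) = 0 by apply: hw_inj; rewrite Psi0 linear0.
    by move/(congr1 vsval); rewrite vsprojK ?memv_pi.
  rewrite add0r; apply/eqP; rewrite -memv0 -R10 memv_cap memv_pi andbT.
  by rewrite mem_frob_ker Phi0.
exists r; split=> // [q|x|c x y].
- by exists (q, 0); rewrite rE.
- by rewrite !rE /= /DM_F /= Phi_pi.
rewrite !rE /= /DM_F /DM_form /= => ->.
have cR1 : vsval c \in R1 by exact: subvsP.
rewrite daddv_pi_id // vsvalK Phi_pi.
have /eqP -> : hw_Phi (vsval c) == 0 by rewrite -mem_frob_ker.
by rewrite linear0 subr0.
Qed.

Lemma hw_quotient_iso (D1 D2 : polDM) H (r : 'Hom(D1, H)) :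
  polDM_iso D1 D2 -> hw_quotient r -> exists r2 : 'Hom(D2, H), hw_quotient r2.
Proof.
case=> f [fb fF _ fform] [r_surj r0 rF rPsi]; have fK := bij_lfunVK fb.
have fI := bij_inj fb.
exists (r \o f^-1)%VF; split=> [q|x|x|c x y]; rewrite ?comp_lfunE.
- have [x <-] := r_surj q; exists (f x).
  by rewrite comp_lfunE lker0_lfunK ?bij_lker0.
- rewrite r0 -[x in X in _ <-> X]fK -fF; split=> [->|]; first by rewrite linear0.
  by rewrite -[in X in X -> _](linear0 f) => /fI.
- by rewrite -[x in LHS]fK -fF lker0_lfunK ?bij_lker0.
by move/rPsi => ->; rewrite -fform fF !fK.
Qed.

(** The condition on Psi without the inverse of the transpose of f. *)
Lemma hw_isoP H1 H2 : hw_iso H1 H2 <-> exists f : 'Hom(H1, H2),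
  [/\ bijective f, forall q, hw_Phi (f q) = f (hw_Phi q) &
    forall (x1 : subvs_of (frob_ker hk (hw_Phi (h := H1))))
           (x2 : subvs_of (frob_ker hk (hw_Phi (h := H2)))) q,
      vsval x2 = f (vsval x1) -> hw_Psi x2 (f q) = hw_Psi x1 q].
Proof.
split=> -[f [fb fPhi fPsi]]; exists f; split=> // x1 x2.
  by move=> q xf; rewrite (fPsi _ _ xf) -dual_mapE bij_lfunVK //; apply: dual_map_bij.
have db := dual_map_bij fb; move=> xf.
apply: (bij_inj db); rewrite bij_lfunVK //; apply/lfunP => q.
by rewrite dual_mapE (fPsi _ _ q xf).
Qed.

(** * Isomorphisms *)

Lemma hw_iso_refl H : hw_iso H H.
Proof.
apply/hw_isoP; exists \1%VF; split=> [|q|x1 x2 q].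
- by exists \1%VF => x; rewrite !id_lfunE.
- by rewrite !id_lfunE.
by rewrite !id_lfunE => /val_inj ->.
Qed.

Lemma hw_iso_sym H1 H2 : hw_iso H1 H2 -> hw_iso H2 H1.
Proof.
move/hw_isoP => [f [fb fPhi fPsi]]; apply/hw_isoP.
have fK := bij_lfunVK fb; have fI := bij_inj fb.
exists (f^-1)%VF; split=> [|q|x1 x2 q xf]; first exact: lfun_inv_bij.
  by apply: fI; rewrite -fPhi !fK.
by rewrite -(fPsi x2 x1) ?fK // xf fK.
Qed.

Lemma hw_iso_trans H1 H2 H3 : hw_iso H1 H2 -> hw_iso H2 H3 -> hw_iso H1 H3.
Proof.
move=> /hw_isoP[f [fb fPhi fPsi]] /hw_isoP[g [gb gPhi gPsi]]; apply/hw_isoP.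
exists (g \o f)%VF; split=> [|q|x1 x3 q]; rewrite ?comp_lfunE.
- have [f' fK f'K] := fb; have [g' gK g'K] := gb; exists (f' \o g') => x /=.
    by rewrite comp_lfunE gK fK.
  by rewrite comp_lfunE f'K g'K.
- by rewrite gPhi fPhi.
move=> xgf; have x2R : f (vsval x1) \in frob_ker hk (hw_Phi (h := H2)).
  have := subvsP x1; rewrite !mem_frob_ker fPhi => /eqP ->.
  by rewrite linear0.
by rewrite (gPsi (Subvs x2R)) // (fPsi x1).
Qed.

Lemma polDM_iso_refl D : polDM_iso D D.
Proof.
exists \1%VF; split=> [|x|x|x y]; rewrite ?id_lfunE //.
by exists \1%VF => x; rewrite !id_lfunE.
Qed.

Lemma polDM_iso_sym D1 D2 : polDM_iso D1 D2 -> polDM_iso D2 D1.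
Proof.
move=> [f [fb fF fV fform]]; have fK := bij_lfunVK fb; have fI := bij_inj fb.
exists (f^-1)%VF; split=> [|x|x|x y]; first exact: lfun_inv_bij.
- by apply: fI; rewrite fF !fK.
- by apply: fI; rewrite fV !fK.
by rewrite -fform !fK.
Qed.

Lemma polDM_iso_trans D1 D2 D3 :
  polDM_iso D1 D2 -> polDM_iso D2 D3 -> polDM_iso D1 D3.
Proof.
move=> [f [fb fF fV fform]] [g [gb gF gV gform]].
exists (g \o f)%VF; split=> [|x|x|x y]; rewrite ?comp_lfunE.
- have [f' fK f'K] := fb; have [g' gK g'K] := gb; exists (f' \o g') => x /=.
    by rewrite comp_lfunE gK fK.
  by rewrite comp_lfunE f'K g'K.
- by rewrite fF gF.
- by rewrite fV gV.
by rewrite gform fform.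
Qed.

(** * Comparison of HW and DM *)

Lemma hw_isoE D H : hw_iso (HW D) H <-> exists r : 'Hom(D, H), hw_quotient r.
Proof.
pose K := frob_ker hk (dm_F (d := D)); pose pi := @qpi k D K.
have piE x : linfun pi x = pi x by rewrite lfunE.
split=> [/hw_isoP[f [fb fPhi fPsi]]|[r [r_surj r0 rF rPsi]]].
  have fI := bij_inj fb.
  have HWPhi x : hw_Phi (h := HW D) (pi x) = pi (dm_F x) by exact: HW_Phi_pi.
  have HWPsi c x : hw_Psi (h := HW D) c (pi x) = pdm_form x (dm_F (repr (vsval c))).
    by rewrite lfunE; exact: HW_form_pi.
  pose r : 'Hom(D, H) := (f \o linfun pi)%VF.
  have rE x : r x = f (pi x) by rewrite comp_lfunE piE.
  exists r; split=> [q|x|x|c x y]; rewrite ?rE.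
  - by exists (repr ((f^-1)%VF q)); rewrite rE /pi reprqK bij_lfunVK.
  - rewrite -[X in _ = X](linear0 f); split=> [/fI/eqP|Fx0].
      by rewrite qpi_eq0 mem_frob_ker => /eqP.
    by congr (f _); apply/eqP; rewrite qpi_eq0 mem_frob_ker Fx0.
  - by rewrite fPhi HWPhi.
  move=> fx; have xK : pi x \in frob_ker hk (hw_Phi (h := HW D)).
    rewrite mem_frob_ker; apply/eqP/fI; rewrite -fPhi fx linear0.
    by apply/eqP; rewrite -mem_frob_ker subvsP.
  by rewrite (fPsi (Subvs xK)) // HWPsi HW_F_repr.
have r_pi x : r (repr (pi x)) = r x.
  have := repr_qpi K x; rewrite mem_frob_ker => /eqP/r0/eqP.
  by rewrite linearB subr_eq0 => /eqP.
pose f (q : quotv K) := r (repr q).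
have f_lin : linear (f : HW D -> H).
  move=> a q q'; rewrite /f -[q]reprqK -[q']reprqK -(linearP pi) !r_pi.
  by rewrite linearP.
pose f' : {linear HW D -> H} := HB.pack (f : HW D -> H)
  (GRing.isLinear.Build k (HW D) H _ _ f_lin).
have fE q : linfun f' q = r (repr q) by rewrite lfunE.
apply/hw_isoP; exists (linfun f'); split=> [|q|x1 x2 q].
- apply: lfun_bij => [q q'|q]; last first.
    by have [x <-] := r_surj q; exists (pi x); rewrite fE r_pi.
  rewrite !fE => /eqP; rewrite -subr_eq0 -(linearB r) => /eqP/r0/eqP.
  by rewrite -mem_frob_ker -qpiE !reprqK => /eqP.
- by rewrite !fE -rF /= /HW_Phi r_pi.
rewrite !fE => xf; rewrite (rPsi _ (repr (vsval x1))) //.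
by rewrite lfunE.
Qed.

Lemma ex_complement H : exists R0, complement (frob_ker hk (hw_Phi (h := H))) R0.
Proof. by eexists; split; [exact: capv_compl | exact: addv_complf]. Qed.

(** If HW D1 ~ HW D2, then both D1 and D2 present the triple HW D2, so both are
    isomorphic to DM (HW D2). *)
Lemma hw_iso_HW D1 D2 : hw_iso (HW D1) (HW D2) <-> polDM_iso D1 D2.
Proof.
split=> [/hw_isoE[r rP]|D12].
  have [R0 R0P] := ex_complement (HW D2).
  apply: (polDM_iso_trans (hw_quotient_DM R0P rP)); apply: polDM_iso_sym.
  have /hw_isoE[r2 r2P] := hw_iso_refl (HW D2).
  exact: hw_quotient_DM r2P.
apply/hw_iso_sym/hw_isoE; have /hw_isoE[r rP] := hw_iso_refl (HW D1).
exact: hw_quotient_iso rP.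
Qed.

Lemma DM_iso H (R0 : {vspace H})
    (R0P : complement (frob_ker hk (hw_Phi (h := H))) R0) D :
  polDM_iso (DM R0P) D <-> hw_iso H (HW D).
Proof.
have /hw_isoE HWDM := DM_hw_quotient R0P; rewrite -hw_iso_HW.
split=> [iso|iso]; last exact: hw_iso_trans iso.
exact: hw_iso_trans (hw_iso_sym HWDM) iso.
Qed.

Lemma dim_DM H (R0 : {vspace H})
    (R0P : complement (frob_ker hk (hw_Phi (h := H))) R0) :
  \dim (fullv : {vspace DM R0P}) = (2 * \dim (fullv : {vspace H}))%N.
Proof.
have -> : \dim (fullv : {vspace DM R0P}) = (dim H + dim H * 1)%N by rewrite dimvf.
by rewrite dimvf muln1 mul2n addnn.
Qed.

Lemma dim_polDM_iso D1 D2 : polDM_iso D1 D2 ->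
  \dim (fullv : {vspace D1}) = \dim (fullv : {vspace D2}).
Proof. by case=> f [/lfun_bij_dim]. Qed.

Lemma dim_HW D :
  \dim (fullv : {vspace D}) = (2 * \dim (fullv : {vspace HW D}))%N.
Proof.
have [R0 R0P] := ex_complement (HW D).
have /dim_polDM_iso <- : polDM_iso (DM R0P) D by apply/DM_iso/hw_iso_refl.
exact: dim_DM.
Qed.

End Presentation.

(** * Isomorphism classes *)

Section IsoClasses.
Variables (T : Type) (iso : T -> T -> Prop) (A : T -> Prop).

Lemma iso_class_ext (C1 C2 : iso_class iso A) :
  (forall x, in_class x C1 <-> in_class x C2) -> C1 = C2.
Proof.
case: C1 C2 => [C1 C1P] [C2 C2P] eC.
by apply: eq_exist; apply/funext => x; apply/propext; exact: eC.
Qed.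

Lemma iso_class_rep (C : iso_class iso A) :
  exists2 x, A x & forall y, in_class y C <-> iso x y.
Proof. by case: C => C [x [Ax eC]]; exists x => // y; rewrite /in_class /= eC. Qed.

End IsoClasses.

Theorem theorem2p8 (k : fieldType) (p : nat) (hp : p \in [pchar k])
    (hk : perfect_field k p) (g : nat) (hg : (1 <= g)%N) :
  exists (hw : polDM_classes hp hk (2 * g) -> hw_classes hp hk g)
         (dm : hw_classes hp hk g -> polDM_classes hp hk (2 * g)),
    [/\ forall (C : polDM_classes hp hk (2 * g)) (D : polDM hp hk),
          in_class D C -> in_class (HW D) (hw C),
        forall (C : hw_classes hp hk g) (H : hwTriple hp hk) (R0 : {vspace H})
            (hR0 : complement (frob_ker hk (hw_Phi (h := H))) R0),
          in_class H C -> in_class (DM hR0) (dm C),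
        cancel hw dm &
        cancel dm hw].
Proof.
have hwP (C : polDM_classes hp hk (2 * g)) : exists H : hwTriple hp hk,
    \dim (fullv : {vspace H}) = g /\
    (fun H' => exists2 D, in_class D C & hw_iso (HW D) H') = hw_iso H.
  have [D dimD CE] := iso_class_rep C; exists (HW D); split.
    by apply/eqP; rewrite -(eqn_pmul2l (m := 2)) // -dim_HW dimD.
  apply/funext => H; apply/propext; split=> [[D' /CE DD']|HH].
    by apply: hw_iso_trans; apply/hw_iso_HW.
  by exists D => //; apply/CE; exact: polDM_iso_refl.
(* The class of DM H consists of the D with HW D in the class of H; defined in
   this way, dm involves no choice of H or R0. *)
have dmP (C : hw_classes hp hk g) : exists D : polDM hp hk,
    \dim (fullv : {vspace D}) = (2 * g)%N /\
    (fun D' => in_class (HW D') C) = polDM_iso D.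
  have [H dimH CE] := iso_class_rep C; have [R0 R0P] := ex_complement H.
  exists (DM R0P); split; first by rewrite dim_DM dimH.
  by apply/funext => D; apply/propext; rewrite DM_iso CE.
pose hw C : hw_classes hp hk g := exist _ _ (hwP C).
pose dm C : polDM_classes hp hk (2 * g) := exist _ _ (dmP C).
have dm_DM (C : hw_classes hp hk g) (H : hwTriple hp hk) (R0 : {vspace H})
    (R0P : complement (frob_ker hk (hw_Phi (h := H))) R0) :
    in_class H C -> in_class (HW (DM R0P)) C.
  have [H0 _ CE] := iso_class_rep C => /CE H0H; apply/CE.
  by apply: hw_iso_trans H0H _; apply/(DM_iso R0P)/polDM_iso_refl.
exists hw, dm; split=> [C D DC|C H R0 R0P|C|C].
- by exists D => //; exact: hw_iso_refl.
- exact: dm_DM.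
- apply: iso_class_ext => D; split=> [[D' D'C]|DC]; last first.
    by exists D => //; exact: hw_iso_refl.
  have [D0 _ CE] := iso_class_rep C; move/hw_iso_HW => D'D; apply/CE.
  by move/CE: D'C => /polDM_iso_trans; apply.
apply: iso_class_ext => H; split=> [[D DC]|HC].
  have [H0 _ CE] := iso_class_rep C; move/CE: DC => H0D /(hw_iso_trans H0D) H0H.
  exact/CE.
have [R0 R0P] := ex_complement H; exists (DM R0P); first exact: dm_DM.
by apply/hw_iso_sym/(DM_iso R0P)/polDM_iso_refl.
Qed.
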